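(* Let $\mathcal{R}$ be a fusion ring with basis $\{x_1=1,\ldots,x_m\}$, fusion matrices $M_j$ and $d_j=\|M_j\|$, and let $\mathcal{B}=\mathcal{R}\otimes_{\mathbb{Z}}\mathbb{C}$ with its $C^*$-algebra structure. Let $\Delta:\mathcal{B}\to\mathcal{B}\otimes\mathcal{B}$ be the linear map with $\Delta(x_j)=\frac{1}{d_j}x_j\otimes x_j$, and for $n\ge1$ let $T_n=\sum_{i=1}^m\|M_i\|^2\big(M_i/\|M_i\|\big)^{\otimes n}$ be the primary $n$-matrix. The following are equivalent: (1) $\Delta$ is completely positive; (2) $T_3\geq0$; (3) $T_n\geq0$ for some $n\geq 3$; (4) $T_n\geq 0$ for every $n\in\mathbb{N}$, $n\ge1$.
   Context: A fusion ring is a ring $\mathcal{R}$ which is a free $\mathbb{Z}$-module with a finite basis $\{x_1=1,\ldots,x_m\}$ such that $x_ix_j=\sum_k N_{ij}^k x_k$ with $N_{ij}^k\in\mathbb{N}$; there is an involution $i\mapsto i^*$ whose $\mathbb{Z}$-linear extension is an anti-involution of $\mathcal{R}$; and the coefficient of $x_1$ in $x_ix_j$ equals $\delta_{i,j^*}$. $\mathcal{B}=\mathcal{R}\otimes_\mathbb{Z}\mathbb{C}$ is the complex algebra with involution $(\sum c_jx_j)^*=\sum\overline{c_j}x_{j^*}$ and faithful trace $\tau(x_j)=\delta_{j,1}$; it is a finite-dimensional $C^*$-algebra (acting on $L^2(\mathcal{B},\tau)$, in which $\{x_j\}$ is orthonormal). The fusion matrix $M_j$ is the matrix of left multiplication by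 $x_j$, $(M_j)_{k,i}=N_{ji}^k$, and $\|M_j\|$ its operator norm on $\mathbb{C}^m$. $A\geq0$ means positive semidefinite. *)

(* Defs.v *)
From HB Require Import structures.
From mathcomp Require Import all_boot all_order all_algebra.
From mathcomp Require Import complex mxtens.
From mathcomp Require Import boolp classical_sets reals.

Set Implicit Arguments.
Unset Strict Implicit.
Unset Printing Implicit Defensive.

Import Order.TTheory GRing.Theory Num.Theory.
Local Open Scope ring_scope.

(* Fusion rings.  The basis {x_i} is indexed by 'I_m; [one] is the index of  *)
(* the unit x_1 = 1; x_i x_j = \sum_k N i j k x_k; [dual] is i |-> i^*.      *)
Definition is_fusion_ring (m : nat) (N : 'I_m -> 'I_m -> 'I_m -> nat)
    (one : 'I_m) (dual : 'I_m -> 'I_m) : Prop :=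
      (forall i k, N one i k = (i == k) :> nat) /\
      (forall i k, N i one k = (i == k) :> nat) /\
      (forall i j l p,
         (\sum_(k < m) N i j k * N k l p = \sum_(k < m) N j l k * N i k p)%N) /\
      (forall i, dual (dual i) = i) /\
      (* its Z-linear extension is an anti-homomorphism: (x_i x_j)^* = x_j^* x_i^* *)
      (forall i j k, N i j (dual k) = N (dual j) (dual i) k) /\
      (forall i j, N i j one = (i == dual j) :> nat).

Section Defs.
Variable R : realType.
Local Notation C := R[i].

Definition fusion_mx (m : nat) (N : 'I_m -> 'I_m -> 'I_m -> nat) (j : 'I_m)
  : 'M[C]_m := \matrix_(k, i) (N j i k)%:R.

Definition vnorm (n : nat) (v : 'cV[C]_n) : R :=
  Num.sqrt (\sum_(i < n) (complex.Re (v i 0) ^+ 2 + complex.Im (v i 0) ^+ 2)).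

Definition opnorm (n : nat) (A : 'M[C]_n) : R :=
  sup [set r : R | exists v : 'cV[C]_n, vnorm v <= 1 /\ r = vnorm (A *m v)].

Definition psd (n : nat) (A : 'M[C]_n) : Prop :=
  (forall i j, A j i = Num.conj (A i j)) /\
  (forall v : 'cV[C]_n,
      0 <= \sum_(i < n) \sum_(j < n) Num.conj (v i 0) * A i j * v j 0).

(* Elements of B are coefficient vectors c (b = \sum_j c j x_j); B acts on
   L^2(B,tau) (orthonormal basis {x_j}) by left multiplication, x_j |-> M_j. *)
Definition Lrep (m : nat) (N : 'I_m -> 'I_m -> 'I_m -> nat) (c : 'I_m -> C)
  : 'M[C]_m := \sum_(j < m) c j *: fusion_mx N j.

(* Elements of B (x) B are coefficient arrays e (\sum e i j x_i (x) x_j),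
   acting on L^2(B) (x) L^2(B) by x_i (x) x_j |-> M_i (x) M_j. *)
Definition Lrep2 (m : nat) (N : 'I_m -> 'I_m -> 'I_m -> nat)
  (e : 'I_m -> 'I_m -> C) : 'M[C]_(m * m) :=
  \sum_(i < m) \sum_(j < m) e i j *: (fusion_mx N i *t fusion_mx N j).

(* An element X of M_k(A), where A is represented in 'M_n, acts on
   C^k (x) C^n as the block matrix (X p q)_{p,q}. *)
Definition blockmx (k n : nat) (X : 'I_k -> 'I_k -> 'M[C]_n) : 'M[C]_(k * n) :=
  \matrix_(a, b) X (mxtens_unindex a).1 (mxtens_unindex b).1
                   (mxtens_unindex a).2 (mxtens_unindex b).2.

Definition fdim (m : nat) (N : 'I_m -> 'I_m -> 'I_m -> nat) (j : 'I_m) : R :=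
  opnorm (fusion_mx N j).

Definition Delta (m : nat) (N : 'I_m -> 'I_m -> 'I_m -> nat) (c : 'I_m -> C)
  : 'I_m -> 'I_m -> C :=
  fun i j => if i == j then c i / ((fdim N i)%:C)%C else 0.

Definition Delta_cp (m : nat) (N : 'I_m -> 'I_m -> 'I_m -> nat) : Prop :=
  forall (k : nat) (X : 'I_k -> 'I_k -> 'I_m -> C),
    psd (blockmx (fun p q => Lrep N (X p q))) ->
    psd (blockmx (fun p q => Lrep2 N (Delta N (X p q)))).

Definition primary_mx (m : nat) (N : 'I_m -> 'I_m -> 'I_m -> nat) (n : nat)
  : 'M[C]_(m ^ n) :=
  \sum_(i < m) (((fdim N i) ^+ 2)%:C)%C *:
     ntensmx ((((fdim N i)^-1)%:C)%C *: fusion_mx N i) n.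

End Defs.

(* Main.v *)
Require Import Defs.
From HB Require Import structures.
From mathcomp Require Import all_boot all_order all_algebra.
From mathcomp Require Import complex mxtens.
From mathcomp Require Import boolp classical_sets reals.
From mathcomp Require Import ring.

Set Implicit Arguments.
Unset Strict Implicit.
Unset Printing Implicit Defensive.

Import Order.TTheory GRing.Theory Num.Theory.
Local Open Scope ring_scope.

(* T_2 is always positive, and T_(n+1) is the image of T_n under Delta applied
   to one tensor factor, so complete positivity of Delta propagates positivity
   from T_2 upwards.  Downwards, the common Perron-Frobenius vector u satisfies
   M_i u = ||M_i|| u, so compressing one tensor factor of T_(n+1) to u gives a
   positive multiple of T_n; hence positivity of any T_n with n >= 3 yields that
   of T_3.  Finally, write a positive X in M_k(B) as Y Y with Y hermitian in
   M_k(B): Frobenius reciprocity turns the coefficients of X into a sum of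
   expressions V^* M_j V with V independent of j, so (1 (x) Delta)(X) is a sum of
   compressions of T_3. *)

(** * Positive matrices, spectral calculus and square roots *)

Section PositiveMatrices.
Variable C : numClosedFieldType.

Definition adj {m n} (A : 'M[C]_(m, n)) : 'M[C]_(n, m) := map_mx Num.conj A^T.
Local Notation "A ^H" := (adj A) (at level 8, format "A ^H").

(** The matrix-product form of [psd], over any numerically closed field: compressions then reduce to
    associativity. The two are identified in [psdP]. *)
Definition posmx n (A : 'M[C]_n) : Prop :=
  A^H = A /\ forall v : 'cV[C]_n, 0 <= (v^H *m A *m v) 0 0.

Lemma adjE m n (A : 'M[C]_(m, n)) i j : A^H i j = Num.conj (A j i).
Proof. by rewrite !mxE. Qed.

Lemma adjM m n p (A : 'M[C]_(m, n)) (B : 'M[C]_(n, p)) :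
  (A *m B)^H = B^H *m A^H.
Proof. by rewrite /adj trmx_mul map_mxM. Qed.

Lemma adjK m n (A : 'M[C]_(m, n)) : A^H^H = A.
Proof. by apply/matrixP=> i j; rewrite !adjE conjCK. Qed.

Lemma sqnormE n (v : 'cV[C]_n) : (v^H *m v) 0 0 = \sum_i `|v i 0| ^+ 2.
Proof. by rewrite mxE; apply: eq_bigr => i _; rewrite adjE normCK mulrC. Qed.

Lemma sqnorm_ge0 n (v : 'cV[C]_n) : 0 <= (v^H *m v) 0 0.
Proof. by rewrite sqnormE sumr_ge0 // => i _; rewrite exprn_ge0. Qed.

Lemma sqnorm_eq0 n (v : 'cV[C]_n) : (v^H *m v) 0 0 = 0 -> v = 0.
Proof.
rewrite sqnormE => /psumr_eq0P v0; apply/colP => i; rewrite mxE.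
have /eqP := v0 (fun i _ => exprn_ge0 2 (normr_ge0 (v i 0))) i isT.
by rewrite expf_eq0 normr_eq0 => /eqP.
Qed.

Lemma sqnorm_gt0 n (v : 'cV[C]_n) : v != 0 -> 0 < (v^H *m v) 0 0.
Proof.
move=> v0; rewrite lt_neqAle sqnorm_ge0 andbT eq_sym.
by apply: contraNneq v0 => /sqnorm_eq0 ->.
Qed.

Lemma posmx0 n : posmx (0 : 'M[C]_n).
Proof.
split=> [|v]; last by rewrite mulmx0 mul0mx mxE.
by apply/matrixP => i j; rewrite adjE !mxE conjC0.
Qed.

Lemma posmxD n (A B : 'M[C]_n) : posmx A -> posmx B -> posmx (A + B).
Proof.
move=> [hA pA] [hB pB]; split=> [|v].
  by rewrite /adj linearD map_mxD -/(adj A) -/(adj B) hA hB.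
by rewrite mulmxDr mulmxDl mxE addr_ge0.
Qed.

Lemma posmx_sum n (I : finType) (F : I -> 'M[C]_n) :
  (forall i, posmx (F i)) -> posmx (\sum_i F i).
Proof. by move=> pF; elim/big_ind: _ => //; [exact: posmx0|exact: posmxD]. Qed.

Lemma posmx_conj m n (W : 'M[C]_(m, n)) (A : 'M[C]_m) :
  posmx A -> posmx (W^H *m A *m W).
Proof.
move=> [hA pA]; split=> [|v]; first by rewrite !adjM adjK hA mulmxA.
by have := pA (W *m v); rewrite adjM !mulmxA.
Qed.

Lemma posmx_scale n (a : C) (A : 'M[C]_n) : 0 <= a -> posmx A -> posmx (a *: A).
Proof.
move=> a0 [hA pA]; split=> [|v].
  apply/matrixP => i j; rewrite adjE !mxE rmorphM /= -adjE hA.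
  by rewrite (CrealP (ger0_real a0)).
by rewrite -scalemxAr -scalemxAl mxE mulr_ge0.
Qed.

(** This is compression by the 0-1 matrix whose column i is the basis vector at f i. As f is
    arbitrary, it covers permutations of tensor factors. *)
Lemma posmx_reindex m n (f : 'I_m -> 'I_n) (A : 'M[C]_n) :
  posmx A -> posmx (mxsub f f A).
Proof.
move=> /(posmx_conj (colsub f 1%:M)).
rewrite (_ : _ *m _ = mxsub f f A) //.
apply/matrixP => i j; rewrite !mxE (bigD1 (f j)) //= !mxE eqxx mulr1.
rewrite [X in _ + X]big1 ?addr0 => [|k kj]; last first.
  by rewrite !mxE (negPf kj) mulr0.
rewrite (bigD1 (f i)) //= !mxE eqxx conjC1 mul1r big1 ?addr0 // => k ki.
by rewrite !mxE (negPf ki) conjC0 mul0r.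
Qed.

Lemma posmx_gram m n (W : 'M[C]_(m, n)) : posmx (W^H *m W).
Proof.
split=> [|v]; first by rewrite adjM adjK.
by have := sqnorm_ge0 (W *m v); rewrite adjM !mulmxA.
Qed.

Lemma hermitian_diagonalization n (A : 'M[C]_n) : A^H = A ->
  exists (P : 'M[C]_n) (D : 'rV[C]_n),
    [/\ P *m P^H = 1%:M, P^H *m P = 1%:M,
        forall i, D 0 i \is Num.real & A = P^H *m diag_mx D *m P].
Proof.
move=> hA; have Aherm : A \is hermsymmx.
  by apply/is_hermitianmxP; rewrite expr0 scale1r -{1}hA.
have /orthomx_spectralP Aeq := hermitian_normalmx Aherm.
have Pu := spectral_unitarymx A.
exists (spectralmx A), (spectral_diag A).
have PP : spectralmx A *m (spectralmx A)^H = 1%:M by exact/unitarymxP.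
split=> //; first by rewrite (mulmx1C PP).
  by move=> i; exact: (mxOverP (hermitian_spectral_diag_real Aherm)).
by rewrite {1}Aeq invmx_unitary.
Qed.

Lemma diagonalization_eigen n (A P : 'M[C]_n) (D : 'rV[C]_n) i :
  P *m P^H = 1%:M -> A = P^H *m diag_mx D *m P ->
  col i P^H != 0 /\ A *m col i P^H = D 0 i *: col i P^H.
Proof.
move=> PP Aeq; split.
  apply/eqP => ci0; have /matrixP/(_ i i) := PP.
  rewrite !mxE eqxx big1 => [/esym/eqP|k _]; first by rewrite oner_eq0.
  by have /colP/(_ k) := ci0; rewrite !mxE => ->; rewrite mulr0.
rewrite !colE mulmxA Aeq -[_ *m P *m _]mulmxA PP mulmx1 -!colE.
by apply/colP => k; rewrite mul_mx_diag !mxE mulrC.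
Qed.

Lemma posmx_eigen n (A : 'M[C]_n) : A^H = A ->
  (forall (a : C) (v : 'cV[C]_n), v != 0 -> A *m v = a *: v -> 0 <= a) ->
  posmx A.
Proof.
move=> hA eigA; split=> // v.
have [P [D [PP _ _ Aeq]]] := hermitian_diagonalization hA.
have D0 i : 0 <= D 0 i.
  by have [/eigA] := diagonalization_eigen i PP Aeq; apply.
rewrite Aeq !mulmxA -adjM -mulmxA mxE sumr_ge0 // => i _.
by rewrite mul_mx_diag mxE adjE mulrAC mulr_ge0 // mulrC mul_conjC_ge0.
Qed.

Lemma eigen_quad n (A : 'M[C]_n) a (v : 'cV[C]_n) :
  A *m v = a *: v -> (v^H *m A *m v) 0 0 = a * (v^H *m v) 0 0.
Proof. by move=> e; rewrite -mulmxA e -scalemxAr mxE. Qed.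

(** If A v = a v with a nonzero, applying A A = Z A to v and cancelling a gives a |v|^2 = v^* Z v,
    so no eigenvalue of A is negative. *)
Lemma posmx_sq n (A Z : 'M[C]_n) :
  A^H = A -> posmx Z -> A *m A = Z *m A -> posmx A.
Proof.
move=> hA [_ pZ] AA; apply: posmx_eigen => // a v v0 Av.
have vv := sqnorm_gt0 v0.
have [->//|a0] := eqVneq a 0.
have : a * (a * (v^H *m v) 0 0) = a * (v^H *m Z *m v) 0 0.
  rewrite -(eigen_quad Av) -[v^H *m A *m v]mulmxA Av.
  rewrite -scalemxAr [in LHS]mxE mulrA -expr2.
  have -> : a ^+ 2 * (v^H *m v) 0 0 = (v^H *m (A *m A *m v)) 0 0.
    by rewrite -mulmxA Av -scalemxAr Av scalerA -scalemxAr [RHS]mxE expr2.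
  by rewrite AA -[Z *m A *m v]mulmxA Av -!scalemxAr mxE mulmxA.
by move=> /(mulfI a0) e; move: (pZ v); rewrite -e pmulr_lge0.
Qed.

(** Commuting with D forces B i j = 0 unless D i = D j, and in that case S i = S j. This plays the
    role of functional calculus. *)
Lemma comm_diag_mx n (D S : 'rV[C]_n) (B : 'M[C]_n) :
  (forall i j, D 0 i = D 0 j -> S 0 i = S 0 j) ->
  diag_mx D *m B = B *m diag_mx D -> diag_mx S *m B = B *m diag_mx S.
Proof.
move=> DS /matrixP DB; apply/matrixP => i j; move: (DB i j).
rewrite !mul_diag_mx !mul_mx_diag !mxE => /eqP.
rewrite [B i j * _]mulrC -subr_eq0 -mulrBl mulf_eq0 subr_eq0.
by case/orP => [/eqP/DS->|/eqP->]; rewrite ?mulr0 ?mul0r // mulrC.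
Qed.

(** Square roots are taken of the eigenvalues. The commutation clause is what later keeps the square
    root of an element of M_k(B) inside M_k(B). *)
Lemma posmx_sqrt n (A : 'M[C]_n) : posmx A ->
  exists Y : 'M[C]_n, [/\ Y^H = Y, Y *m Y = A &
    forall B, A *m B = B *m A -> Y *m B = B *m Y].
Proof.
move=> [hA pA]; have [P [D [PP PP' Dr Aeq]]] := hermitian_diagonalization hA.
have D0 i : 0 <= D 0 i.
  have [/sqnorm_gt0 c0 /eigen_quad e] := diagonalization_eigen i PP Aeq.
  by have := pA (col i P^H); rewrite e pmulr_lge0.
pose S : 'rV[C]_n := \row_i sqrtC (D 0 i).
have SS : diag_mx S *m diag_mx S = diag_mx D.
  apply/matrixP => i j; rewrite mul_diag_mx !mxE.
  by case: eqVneq => [->|]; rewrite ?mulr0n ?mulr0 // !mulr1n -expr2 sqrtCK.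
exists (P^H *m diag_mx S *m P); split.
- rewrite !adjM adjK mulmxA; congr (_ *m _ *m _).
  apply/matrixP => i j; rewrite adjE !mxE eq_sym.
  case: eqVneq => [->|]; rewrite ?mulr0n ?conjC0 // !mulr1n.
  by rewrite (CrealP (ger0_real _)) // sqrtC_ge0.
- by rewrite -!mulmxA [P *m (P^H *m _)]mulmxA PP mul1mx [diag_mx S *m (_ *m _)]mulmxA
     SS !mulmxA -Aeq.
(* In the eigenbasis of A, commutation with A becomes commutation with the diagonal matrix D. *)
move=> B AB; pose B' := P *m B *m P^H.
have DB : diag_mx D *m B' = B' *m diag_mx D.
  have -> : diag_mx D *m B' = P *m (A *m B) *m P^H.
    by rewrite Aeq /B' !mulmxA PP mul1mx.
  by rewrite AB Aeq /B' -!mulmxA PP mulmx1.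
have SB : diag_mx S *m B' = B' *m diag_mx S.
  by apply: comm_diag_mx DB => i j Dij; rewrite !mxE Dij.
have BE : B = P^H *m B' *m P.
  by rewrite /B' !mulmxA PP' mul1mx -mulmxA PP' mulmx1.
clearbody B'; rewrite {}BE.
rewrite -!mulmxA ![P *m (P^H *m _)]mulmxA PP !mul1mx.
by rewrite [diag_mx S *m (B' *m P)]mulmxA SB !mulmxA.
Qed.

(** With A = Y Y and Y hermitian, the quadratic form at v is |Y v|^2. *)
Lemma posmx_null n (A : 'M[C]_n) (v : 'cV[C]_n) :
  posmx A -> (v^H *m A *m v) 0 0 = 0 -> A *m v = 0.
Proof.
move=> /posmx_sqrt[Y [hY <- _]] e; rewrite -mulmxA.
suff -> : Y *m v = 0 by rewrite mulmx0.
by apply: sqnorm_eq0; rewrite adjM hY !mulmxA -[v^H *m Y *m Y]mulmxA.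
Qed.

(** * Perron-Frobenius theory for hermitian matrices with positive entries *)

Lemma max_eigen n (A : 'M[C]_n) (i0 : 'I_n) : A^H = A ->
  exists (a : C) (v : 'cV[C]_n),
    [/\ v != 0, a \is Num.real, A *m v = a *: v & posmx (a%:M - A)].
Proof.
move=> hA; have [P [D [PP PP' Dr Aeq]]] := hermitian_diagonalization hA.
have [i Di] : exists i, forall j, D 0 j <= D 0 i.
  have [i _ Di] := @real_arg_maxP C _ i0 xpredT (D 0) isT (fun j _ => Dr j).
  by exists i => j; exact: Di.
have [v0 vE] := diagonalization_eigen i PP Aeq.
exists (D 0 i), (col i P^H); split=> //.
have -> : (D 0 i)%:M - A = P^H *m diag_mx (\row_j (D 0 i - D 0 j)) *m P.
  have -> : diag_mx (\row_j (D 0 i - D 0 j)) = (D 0 i)%:M - diag_mx D.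
    apply/matrixP => j k; rewrite !mxE.
    by case: eqP => [->|]; rewrite ?mulr1n ?mulr0n ?subr0.
  by rewrite mulmxBr mulmxBl -Aeq mul_mx_scalar -scalemxAl PP' scalemx1.
apply: posmx_conj; split=> [|w].
  apply/matrixP => j k; rewrite adjE !mxE eq_sym.
  case: eqP => [->|]; rewrite ?mulr0n ?conjC0 // !mulr1n.
  by rewrite (CrealP _) // realB.
rewrite mul_mx_diag mxE sumr_ge0 // => j _.
by rewrite !mxE mulrAC mulr_ge0 ?subr_ge0 // mulrC mul_conjC_ge0.
Qed.

(** Take v for the top eigenvalue a and u = |v| entrywise. The triangle inequality gives u^* S u >=
    a |u|^2, so the positive form of a - S vanishes at u, and u is an eigenvector too. *)
Lemma perron_frobenius n (S : 'M[C]_n) (i0 : 'I_n) :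
  S^H = S -> (forall i j, 0 < S i j) ->
  exists (a : C) (u : 'cV[C]_n), [/\ forall i, 0 < u i 0, S *m u = a *: u &
    forall v : 'cV[C]_n, (forall i, 0 <= v i 0) -> S *m v = a *: v ->
      exists t, v = t *: u].
Proof.
move=> hS pS; have [a [v [v0 ra Sv paS]]] := max_eigen i0 hS.
pose u : 'cV[C]_n := \col_i `|v i 0|.
have uv : (u^H *m u) 0 0 = (v^H *m v) 0 0.
  by rewrite !sqnormE; apply: eq_bigr => i _; rewrite mxE normr_id.
have vSu : a * (v^H *m v) 0 0 <= (u^H *m S *m u) 0 0.
  rewrite -(eigen_quad Sv); apply: le_trans (_ : `|(v^H *m S *m v) 0 0| <= _).
    apply: real_ler_norm; rewrite (eigen_quad Sv).
    by rewrite realM // ger0_real // sqnorm_ge0.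
  rewrite -!mulmxA !mxE; apply: le_trans (ler_norm_sum _ _ _) _.
  apply: ler_sum => i _; rewrite normrM.
  have -> : u^H 0 i = `|v^H 0 i| by rewrite !adjE mxE norm_conjC geC0_conj.
  rewrite ler_wpM2l ?normr_ge0 // !mxE.
  apply: le_trans (ler_norm_sum _ _ _) _.
  by apply: ler_sum => j _; rewrite normrM mxE (gtr0_norm (pS i j)).
have Su : S *m u = a *: u.
  apply/esym/eqP; rewrite -subr_eq0 -mul_scalar_mx -mulmxBl; apply/eqP.
  apply: (posmx_null paS); have [_ /(_ u) ge0] := paS.
  apply/eqP; rewrite eq_le ge0 andbT.
  rewrite mulmxBr mulmxBl mul_mx_scalar -scalemxAl mxE [X in X + _]mxE [X in _ + X]mxE.
  by rewrite subr_le0 uv.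
have [k vk] : exists k, v k 0 != 0.
  apply/existsP; apply: contraNT v0; rewrite negb_exists => /forallP v0.
  by apply/eqP/colP => i; rewrite mxE; apply/eqP; rewrite -[_ == _]negbK.
have u_ge0 i : 0 <= u i 0 by rewrite mxE.
(* Row i of S u contains the positive term S i k |v k|, so a u has no zero entry, and neither has
   u. *)
have Su_gt0 i : 0 < a * u i 0.
  have -> : a * u i 0 = (S *m u) i 0 by rewrite Su [RHS]mxE.
  rewrite mxE (bigD1 k) //= ltr_pwDl ?sumr_ge0 // => [|j _].
    by rewrite mulr_gt0 // mxE normr_gt0.
  by rewrite mulr_ge0 // ltW.
have u_gt0 i : 0 < u i 0.
  rewrite lt_neqAle u_ge0 andbT eq_sym.
  by apply: contraTneq (Su_gt0 i) => ->; rewrite mulr0 ltxx.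
clearbody u; exists a, u; split=> // w w_ge0 Sw.
have rwu i : w i 0 / u i 0 \is Num.real by rewrite ger0_real // divr_ge0.
(* Subtract from w the largest multiple of u that leaves y nonnegative. Then y vanishes at k', and
   row k' of S y = a y, having positive coefficients, forces y = 0. *)
have [k' _ k'min] := @real_arg_minP C _ i0 xpredT (fun i => w i 0 / u i 0) isT
  (fun j _ => rwu j).
set t := w k' 0 / u k' 0 in k'min; exists t.
pose y := w - t *: u; apply/eqP; rewrite -subr_eq0 -/y.
have y_ge0 i : 0 <= y i 0.
  by rewrite !mxE subr_ge0 -ler_pdivlMr //; exact: k'min.
have Sy : S *m y = a *: y by rewrite mulmxBr -scalemxAr Su Sw scalerBr !scalerA mulrC.
have yk' : (S *m y) k' 0 = 0.
  by rewrite Sy /y mxE !mxE; have := u_gt0 k'; rewrite /t => /gt_eqF uk;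
     rewrite divfK ?uk // subrr mulr0.
move: yk'; rewrite mxE => /psumr_eq0P yk'.
apply/eqP/colP => i; rewrite [RHS]mxE; apply/eqP.
have /eqP := yk' (fun i _ => mulr_ge0 (ltW (pS k' i)) (y_ge0 i)) i isT.
by rewrite mulf_eq0 gt_eqF.
Qed.

(* Pairing [A |v| >= c |v|] with the positive eigenvector [u] bounds every
   eigenvalue [c] of [A = M^H M] by [r^2]. *)
Lemma posmx_sqnorm_bound n (M : 'M[C]_n) (u : 'cV[C]_n) (r : C) :
  (forall i j, 0 <= M i j) -> (forall i, 0 < u i 0) -> 0 <= r ->
  M *m u = r *: u -> M^H *m u = r *: u -> posmx ((r ^+ 2)%:M - M^H *m M).
Proof.
move=> M0 u0 r0 Mu Mu'; pose A := M^H *m M.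
have A0 i j : 0 <= A i j.
  by rewrite mxE sumr_ge0 // => k _; rewrite adjE mulr_ge0 ?conjC_ge0.
have [hA pA] : posmx A := posmx_gram M.
have Au : A *m u = r ^+ 2 *: u by rewrite -mulmxA Mu -scalemxAr Mu' scalerA -expr2.
apply: posmx_eigen => [|b v v0].
  rewrite -/A /adj linearB /= tr_scalar_mx map_mxB map_scalar_mx /= -/(adj A) hA.
  by rewrite (CrealP (ger0_real _)) // exprn_ge0.
rewrite -/A mulmxBl mul_scalar_mx => bE.
have {bE} Av : A *m v = (r ^+ 2 - b) *: v by rewrite scalerBl -bE opprB addrC subrK.
pose c := r ^+ 2 - b; rewrite -/c in Av.
have c0 : 0 <= c.
  by have := pA v; rewrite (eigen_quad Av) pmulr_lge0 // sqnorm_gt0.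
have -> : b = r ^+ 2 - c by rewrite /c opprB addrC subrK.
rewrite subr_ge0.
have uv_gt0 : 0 < \sum_i u i 0 * `|v i 0|.
  rewrite lt_neqAle eq_sym sumr_ge0 ?andbT => [|i _]; last first.
    by rewrite mulr_ge0 // ltW.
  apply: contra v0 => /eqP/psumr_eq0P v0; apply/eqP/colP => i; rewrite mxE.
  have /eqP := v0 (fun i _ => mulr_ge0 (ltW (u0 i)) (normr_ge0 (v i 0))) i isT.
  by rewrite mulf_eq0 gt_eqF //= normr_eq0 => /eqP.
rewrite -(ler_pM2r uv_gt0) !mulr_sumr.
have -> : \sum_i r ^+ 2 * (u i 0 * `|v i 0|) = \sum_i \sum_j u j 0 * (A j i * `|v i 0|).
  apply: eq_bigr => i _; rewrite mulrA.
  have -> : r ^+ 2 * u i 0 = (A *m u) i 0 by rewrite Au [RHS]mxE.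
  rewrite mxE mulr_suml; apply: eq_bigr => j _.
  rewrite mulrA [u j 0 * _]mulrC; congr (_ * _ * _).
  by rewrite -{1}hA adjE (CrealP (ger0_real _)).
rewrite exchange_big /=; apply: ler_sum => i _.
rewrite mulrCA -mulr_sumr ler_pM2l //.
have -> : c * `|v i 0| = `|(A *m v) i 0| by rewrite Av mxE normrM (ger0_norm c0).
rewrite mxE; apply: le_trans (ler_norm_sum _ _ _) _.
by apply: ler_sum => j _; rewrite normrM (ger0_norm (A0 i j)).
Qed.

End PositiveMatrices.

Local Notation "A ^H" := (adj A) (at level 8, format "A ^H").

(** * Tensor products of matrices: adjoints, bilinearity, compression *)

Lemma sum_mxtens (V : nmodType) m n (F : 'I_(m * n) -> V) :
  \sum_i F i = \sum_i \sum_j F (mxtens_index (i, j)).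
Proof.
rewrite pair_big /= (reindex (@mxtens_index m n)) /=.
  by apply: eq_bigr => -[i j] _.
exists (@mxtens_unindex m n) => i _; [exact: mxtens_indexK|exact: mxtens_unindexK].
Qed.

Section Tensor.
Variable C : numClosedFieldType.

Lemma adj_tens m n p q (A : 'M[C]_(m, n)) (B : 'M[C]_(p, q)) :
  (A *t B)^H = A^H *t B^H.
Proof. by rewrite /adj trmx_tens map_mxT. Qed.

Lemma adj1 n : (1%:M : 'M[C]_n)^H = 1%:M.
Proof. by rewrite /adj trmx1 map_mx1. Qed.

Lemma adj_sum (I : finType) m n (F : I -> 'M[C]_(m, n)) :
  (\sum_i F i)^H = \sum_i (F i)^H.
Proof. by rewrite /adj linear_sum /= map_mx_sum. Qed.

Lemma tens_suml (I : finType) m n p q (F : I -> 'M[C]_(m, n)) (B : 'M[C]_(p, q)) :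
  (\sum_i F i) *t B = \sum_i F i *t B.
Proof.
apply/matrixP => i j; rewrite mxE !summxE mulr_suml.
by apply: eq_bigr => k _; rewrite mxE.
Qed.

Lemma tens_sumr (I : finType) m n p q (A : 'M[C]_(m, n)) (F : I -> 'M[C]_(p, q)) :
  A *t (\sum_i F i) = \sum_i A *t F i.
Proof.
apply/matrixP => i j; rewrite mxE !summxE mulr_sumr.
by apply: eq_bigr => k _; rewrite mxE.
Qed.

Lemma tens_scalel m n p q a (A : 'M[C]_(m, n)) (B : 'M[C]_(p, q)) :
  (a *: A) *t B = a *: (A *t B).
Proof. by apply/matrixP => i j; rewrite !mxE mulrA. Qed.

Lemma tens_scaler m n p q a (A : 'M[C]_(m, n)) (B : 'M[C]_(p, q)) :
  A *t (a *: B) = a *: (A *t B).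
Proof. by apply/matrixP => i j; rewrite !mxE mulrCA. Qed.

Lemma tens_compress m n p (V : 'M[C]_(m, p)) (A : 'M[C]_m) (B : 'M[C]_n) :
  (V *t 1%:M)^H *m (A *t B) *m (V *t 1%:M) = (V^H *m A *m V) *t B.
Proof. by rewrite adj_tens adj1 !tensmx_mul mul1mx mulmx1. Qed.

End Tensor.

(** * Frobenius reciprocity and the multiplication matrices of a fusion ring *)

Section FusionCombinatorics.
Variables (m : nat) (N : 'I_m -> 'I_m -> 'I_m -> nat) (one : 'I_m).
Variable dual : 'I_m -> 'I_m.
Hypothesis HF : is_fusion_ring N one dual.

Lemma fusion_1l i k : N one i k = (i == k) :> nat. Proof. by case: HF. Qed.
Lemma fusion_1r i k : N i one k = (i == k) :> nat. Proof. by case: HF => _ []. Qed.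
Lemma fusionA i j l p :
  (\sum_(k < m) N i j k * N k l p = \sum_(k < m) N j l k * N i k p)%N.
Proof. by case: HF => _ [_ []]. Qed.
Lemma dualK : involutive dual. Proof. by case: HF => _ [_ [_ []]]. Qed.
Lemma fusion_dual i j k : N i j (dual k) = N (dual j) (dual i) k.
Proof. by case: HF => _ [_ [_ [_ []]]]. Qed.
Lemma fusion_one i j : N i j one = (i == dual j) :> nat.
Proof. by case: HF => _ [_ [_ [_ []]]]. Qed.

(** Both sides compute the coefficient of x_1 in x_i x_j x_l, bracketed in the two possible ways. *)
Lemma fusion_rot i j l : N i j (dual l) = N j l (dual i).
Proof.
have := fusionA i j l one.
rewrite (bigD1 (dual l)) //= fusion_one eqxx muln1 big1 ?addn0; last first.
  by move=> k kl; rewrite fusion_one (negPf kl) muln0.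
rewrite (bigD1 (dual i)) //= fusion_one dualK eqxx muln1 big1 ?addn0 //.
move=> k ki; rewrite fusion_one; case: eqP => [ik|]; last by rewrite muln0.
by rewrite ik dualK eqxx in ki.
Qed.

(** Rotation combined with the anti-involution. It makes the adjoint of left multiplication by x_i
    the left multiplication by its dual; [frobeniusr] does the same on the right. *)
Lemma frobeniusl i j k : N (dual i) k j = N i j k.
Proof. by rewrite -[j in LHS]dualK fusion_dual dualK fusion_rot dualK. Qed.

Lemma frobeniusr i j k : N k (dual j) i = N i j k.
Proof. by rewrite -[in RHS](dualK k) fusion_rot fusion_dual dualK. Qed.

(** Otherwise the product of the dual of x_i with x_k would be zero, whereas multiplying it by x_i
    on the left gives x_k with a nonzero coefficient, through the summand x_1 of x_i times its
    dual. *)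
Lemma fusion_onto i k : exists j, (0 < N i j k)%N.
Proof.
have [j Nj|N0] := pickP (fun j => 0 < N (dual i) k j)%N.
  by exists j; rewrite -frobeniusl.
have := fusionA i (dual i) k k; rewrite (bigD1 one) //= fusion_one dualK eqxx.
rewrite fusion_1l eqxx [RHS]big1 // => j _.
by have := N0 j; rewrite lt0n => /negbFE/eqP->; rewrite mul0n.
Qed.

Variable R : realType.
Local Notation C := R[i].
Local Notation M := (fusion_mx R N).

(** Right multiplication by x_j. It supplies a positive matrix commuting with every M_i, and later a
    commutation test for membership in M_k(B). *)
Definition rfusion_mx j : 'M[C]_m := \matrix_(k, i) (N i j k)%:R.

Lemma fusion_mx_adj j : (M j)^H = M (dual j).
Proof. by apply/matrixP => k i; rewrite adjE !mxE conjC_nat frobeniusl. Qed.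

Lemma rfusion_mx_adj j : (rfusion_mx j)^H = rfusion_mx (dual j).
Proof. by apply/matrixP => k i; rewrite adjE !mxE conjC_nat frobeniusr. Qed.

Lemma fusion_mxM i j : M i *m M j = \sum_k (N i j k)%:R *: M k.
Proof.
apply/matrixP => p l; rewrite mxE summxE.
transitivity ((\sum_k N j l k * N i k p)%N%:R : C).
  by rewrite natr_sum; apply: eq_bigr => k _; rewrite !mxE natrM mulrC.
by rewrite -fusionA natr_sum; apply: eq_bigr => k _; rewrite !mxE natrM.
Qed.

Lemma fusion_mx_comm i j : M i *m rfusion_mx j = rfusion_mx j *m M i.
Proof.
apply/matrixP => p l; rewrite !mxE.
transitivity ((\sum_k N l j k * N i k p)%N%:R : C).
  by rewrite natr_sum; apply: eq_bigr => k _; rewrite !mxE natrM mulrC.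
by rewrite -fusionA natr_sum; apply: eq_bigr => k _; rewrite !mxE natrM mulrC.
Qed.

Lemma fusion_mx_tens2_adj : (\sum_i M i *t M i)^H = \sum_i M i *t M i.
Proof.
rewrite adj_sum [RHS](reindex_inj (inv_inj dualK)) /=.
by apply: eq_bigr => i _; rewrite adj_tens fusion_mx_adj.
Qed.

(* [T = \sum_i M_i (x) M_i] satisfies [T^2 = (Z (x) 1) T] for
   [Z = \sum_i M_i M_i^*], by Frobenius reciprocity. *)
Lemma posmx_fusion_tens2 : posmx (\sum_i M i *t M i).
Proof.
pose Z := \sum_i M i *m (M i)^H.
apply: (@posmx_sq _ _ _ (Z *t 1%:M)); first exact: fusion_mx_tens2_adj.
  rewrite tens_suml; apply: posmx_sum => i.
  have -> : M i *m (M i)^H *t 1%:M = ((M i)^H *t (1%:M : 'M_m))^H *m ((M i)^H *t 1%:M).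
    by rewrite adj_tens adjK adj1 tensmx_mul mulmx1.
  exact: posmx_gram.
rewrite mulmx_suml mulmx_sumr.
under eq_bigr => i _.
  rewrite mulmx_sumr.
  under eq_bigr => j _ do rewrite tensmx_mul (fusion_mxM i j) tens_sumr.
  rewrite exchange_big /=; over.
rewrite exchange_big /=; apply: eq_bigr => k _.
rewrite tensmx_mul mul1mx mulmx_suml tens_suml; apply: eq_bigr => i _.
rewrite -mulmxA fusion_mx_adj fusion_mxM mulmx_sumr tens_suml.
apply: eq_bigr => j _.
by rewrite frobeniusl tens_scaler -scalemxAr -fusion_mxM tens_scalel.
Qed.

(** The sum S of the right multiplications is hermitian with positive entries. Each M_i is entrywise
    nonnegative and commutes with S, so M_i u is a nonnegative eigenvector for the Perron
    eigenvalue, hence a multiple of u. *)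
Lemma fusion_perron_vector : exists (u : 'cV[C]_m) (rho : 'I_m -> C),
  forall i, 0 < u i 0 /\ M i *m u = rho i *: u.
Proof.
pose S := \sum_j rfusion_mx j.
have hS : S^H = S.
  rewrite adj_sum [RHS](reindex_inj (inv_inj dualK)) /=.
  by apply: eq_bigr => j _; rewrite rfusion_mx_adj.
have pS i j : 0 < S i j.
  have [k Nk] := fusion_onto j i.
  rewrite summxE (bigD1 k) //= ltr_pwDl ?sumr_ge0 // => [|l _]; rewrite mxE.
    by rewrite ltr0n.
  exact: ler0n.
have [a [u [u0 Su eigS]]] := perron_frobenius one hS pS; exists u.
suff /choice[rho rhoP] : forall i, exists r, M i *m u = r *: u by exists rho.
move=> i; apply: eigS => [k|].
  by rewrite mxE sumr_ge0 // => l _; rewrite mxE mulr_ge0 ?ler0n // ltW.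
rewrite mulmxA (_ : S *m M i = M i *m S) -?mulmxA ?Su ?scalemxAr //.
by rewrite mulmx_suml mulmx_sumr; apply: eq_bigr => j _; rewrite fusion_mx_comm.
Qed.

End FusionCombinatorics.

(** * Operator norms computed from Perron eigenvectors *)

Section OperatorNorm.
Variable R : realType.
Local Notation C := R[i].

Lemma vnorm_ge0 n (v : 'cV[C]_n) : 0 <= vnorm v.
Proof. exact: sqrtr_ge0. Qed.

Lemma vnorm_sqr n (v : 'cV[C]_n) : ((vnorm v ^+ 2)%:C)%C = (v^H *m v) 0 0.
Proof.
rewrite sqr_sqrtr ?sumr_ge0 // => [|i _]; last by rewrite addr_ge0 ?sqr_ge0.
by rewrite sqnormE rmorph_sum; apply: eq_bigr => i _; exact: add_Re2_Im2.
Qed.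

Lemma vnormZ n (a : R) (v : 'cV[C]_n) :
  0 <= a -> vnorm ((a%:C)%C *: v) = a * vnorm v.
Proof.
move=> a0; apply/eqP; rewrite -(@eqrXn2 _ 2) ?mulr_ge0 ?vnorm_ge0 //.
apply/eqP/(@complexI R); rewrite exprMn (rmorphM _ (a ^+ 2)) /= !vnorm_sqr !sqnormE mulr_sumr.
apply: eq_bigr => i _; rewrite mxE normrM exprMn; congr (_ * _).
by rewrite ger0_norm ?ler0c // rmorphXn.
Qed.

(** The upper bound is the positivity of r^2 - M^* M; it is attained at the unit vector u / |u|. *)
Lemma opnorm_perron n (M : 'M[C]_n) (u : 'cV[C]_n) (r : R) :
  (0 < n)%N -> (forall i j, 0 <= M i j) -> (forall i, 0 < u i 0) -> 0 <= r ->
  M *m u = (r%:C)%C *: u -> M^H *m u = (r%:C)%C *: u -> opnorm M = r.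
Proof.
move=> n0 M0 u0 r0 Mu Mu'.
have rC0 : 0 <= (r%:C)%C :> C by rewrite ler0c.
have [_ bound] := posmx_sqnorm_bound M0 u0 rC0 Mu Mu'.
have ub (v : 'cV[C]_n) : vnorm v <= 1 -> vnorm (M *m v) <= r.
  move=> v1; apply: le_trans (_ : r * vnorm v <= _); last by rewrite ler_piMr.
  rewrite -(@ler_pXn2r _ 2) ?nnegrE ?mulr_ge0 ?vnorm_ge0 // -lecR exprMn.
  rewrite (rmorphM _ (r ^+ 2)) /= !vnorm_sqr rmorphXn /= -subr_ge0.
  have := bound v; rewrite mulmxBr mulmxBl mul_mx_scalar -scalemxAl.
  by rewrite mxE [X in X + _]mxE [X in _ + X]mxE adjM !mulmxA.
have vu : 0 < vnorm u.
  rewrite lt_neqAle vnorm_ge0 andbT eq_sym; apply/eqP => vu0.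
  have := vnorm_sqr u; rewrite vu0 expr0n /= => /esym/sqnorm_eq0 ue.
  by have := u0 (Ordinal n0); rewrite ue mxE ltxx.
apply/eqP; rewrite eq_le; apply/andP; split.
  apply: ge_sup => [|_ [v [v1 ->]]]; last exact: ub.
  exists (vnorm (M *m 0)), 0; split=> //.
  by rewrite -(scale0r (0 : 'cV[C]_n)) (vnormZ _ (lexx 0)) mul0r.
apply: ub_le_sup; first by exists r => _ [v [v1 ->]]; exact: ub.
exists (((vnorm u)^-1%:C)%C *: u); split.
  by rewrite vnormZ ?invr_ge0 ?vnorm_ge0 // mulVf ?gt_eqF.
rewrite -scalemxAr Mu !vnormZ ?invr_ge0 ?vnorm_ge0 //.
by rewrite mulrCA mulVf ?mulr1 ?gt_eqF.
Qed.

Lemma psdP n (A : 'M[C]_n) : psd A <-> posmx A.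
Proof.
have quadE (v : 'cV[C]_n) : (v^H *m A *m v) 0 0 =
    \sum_(i < n) \sum_(j < n) Num.conj (v i 0) * A i j * v j 0.
  rewrite mxE exchange_big /=; apply: eq_bigr => j _.
  by rewrite mxE mulr_suml; apply: eq_bigr => i _; rewrite adjE.
split=> [] [hA pA]; split.
- by apply/matrixP => i j; rewrite adjE -hA.
- by move=> v; rewrite quadE.
- by move=> i j; rewrite -{1}hA adjE.
- by move=> v; rewrite -quadE.
Qed.

End OperatorNorm.

(** * Primary matrices and complete positivity of [Delta] *)

Section FusionPositivity.
Variables (m : nat) (N : 'I_m -> 'I_m -> 'I_m -> nat) (one : 'I_m).
Variable dual : 'I_m -> 'I_m.
Hypothesis HF : is_fusion_ring N one dual.
Variable R : realType.
Local Notation C := R[i].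
Local Notation M := (fusion_mx R N).
Local Notation d i := ((fdim R N i)%:C)%C.

Lemma fdim_eigen : exists u : 'cV[C]_m,
  forall i, [/\ 0 < u i 0, 0 < fdim R N i & M i *m u = d i *: u].
Proof.
have [u [rho uP]] := fusion_perron_vector HF R; exists u => i.
have u0 j : 0 < u j 0 by have [] := uP j.
have Mu j : M j *m u = rho j *: u by have [] := uP j.
have M0 j k l : 0 <= M j k l by rewrite mxE ler0n.
(* In row j of M_j u, the term at [one] has coefficient 1, because x_j x_1 = x_j. *)
have rho0 j : 0 < rho j.
  rewrite -(pmulr_lgt0 _ (u0 j)).
  have -> : rho j * u j 0 = (M j *m u) j 0 by rewrite Mu [RHS]mxE.
  rewrite mxE (bigD1 one) //= ltr_pwDl ?sumr_ge0 // => [|l _].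
    by rewrite mxE (fusion_1r HF) eqxx mul1r.
  by rewrite mulr_ge0 // ltW.
(* The matrices M_i and its dual are adjoint, so their quadratic forms at u are conjugate; both are
   real. *)
have rho_dual : rho (dual i) = rho i.
  have uu : (u^H *m u) 0 0 != 0.
    by rewrite gt_eqF // sqnorm_gt0 //; apply: contraTneq (u0 one) => ->; rewrite mxE ltxx.
  apply: (mulIf uu); rewrite -(eigen_quad (Mu (dual i))).
  have : (u^H *m M (dual i) *m u)^H 0 0 = rho i * (u^H *m u) 0 0.
    by rewrite !adjM adjK -(fusion_mx_adj HF) adjK mulmxA (eigen_quad (Mu i)).
  rewrite adjE => <-; rewrite (eigen_quad (Mu _)) geC0_conj //.
  by rewrite mulr_ge0 ?sqnorm_ge0 // ltW.
have rhoE : rho i = ((complex.Re (rho i))%:C)%C.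
  by rewrite RRe_real // gtr0_real.
have re0 : 0 < complex.Re (rho i) by rewrite -ltcR -rhoE.
suff -> : fdim R N i = complex.Re (rho i) by rewrite -rhoE.
apply: (@opnorm_perron _ _ _ u) => //; rewrite -?rhoE //.
- by case: (m) one => // -[].
- exact: ltW.
- by rewrite (fusion_mx_adj HF) Mu rho_dual.
Qed.

Lemma fdim_gt0 i : 0 < fdim R N i.
Proof. by have [u /(_ i)[]] := fdim_eigen. Qed.

Local Notation E i := (((fdim R N i)^-1%:C)%C *: M i).

Lemma primary_mxSS n : primary_mx R N n.+2 =
  \sum_i (((fdim R N i) ^+ 2)%:C)%C *: (E i *t ntensmx (E i) n.+1).
Proof. by []. Qed.

Lemma primary_mx_compress n :
  psd (primary_mx R N n.+2) -> psd (primary_mx R N n.+1).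
Proof.
have [u uP] := fdim_eigen.
have uu : 0 < (u^H *m u) 0 0.
  rewrite sqnorm_gt0 //; have [u0 _ _] := uP one.
  by apply: contraTneq u0 => ->; rewrite mxE ltxx.
have [w wE] : exists w, w = (u^H *m u) 0 0 by eexists.
rewrite -wE in uu.
(* Compressing to u leaves a one-dimensional first factor, which the reindexing removes. *)
move=> /psdP/(posmx_conj (u *t 1%:M))/(posmx_reindex (fun b => mxtens_index (ord0, b))).
move=> pT; apply/psdP.
have uu' : 0 <= w^-1 by rewrite invr_ge0 ltW.
move: (posmx_scale uu' pT); congr posmx; apply/matrixP => a b.
rewrite primary_mxSS mulmx_sumr mulmx_suml !mxE !summxE mulr_sumr.
apply: eq_bigr => i _; rewrite -scalemxAr -scalemxAl tens_compress.
rewrite mxE tensmxE [in RHS]mxE mulrCA; congr (_ * _).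
have [_ di Mu] := uP i.
(* The normalised matrices all fix u, so the scalar produced by the compression is |u|^2 for every
   i. *)
have Eu : E i *m u = 1 *: u.
  by rewrite -scalemxAl Mu scalerA -rmorphM /= mulVf // gt_eqF.
by rewrite (eigen_quad Eu) -wE mul1r mulrA mulVf ?mul1r // gt_eqF.
Qed.

Lemma blockmx_Lrep k (X : 'I_k -> 'I_k -> 'I_m -> C) :
  blockmx (fun p q => Lrep N (X p q)) =
  \sum_j (\matrix_(p, q) X p q j) *t M j.
Proof.
apply/matrixP => a b; rewrite !mxE !summxE.
by apply: eq_bigr => j _; rewrite !mxE.
Qed.

Lemma blockmx_Lrep2_Delta k (X : 'I_k -> 'I_k -> 'I_m -> C) :
  blockmx (fun p q => Lrep2 N (Delta N (X p q))) =
  \sum_j (\matrix_(p, q) X p q j) *t (((fdim R N j)^-1%:C)%C *: (M j *t M j)).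
Proof.
apply/matrixP => a b; rewrite mxE !summxE; apply: eq_bigr => j _.
rewrite summxE (bigD1 j) //= big1 ?addr0 => [|l lj].
  by rewrite !mxE /Delta eqxx fmorphV !mulrA.
by rewrite mxE /Delta eq_sym (negPf lj) mul0r.
Qed.

Lemma primary_mx_Delta n : Delta_cp R N ->
  psd (primary_mx R N n.+2) -> psd (primary_mx R N n.+3).
Proof.
move=> cp.
pose B i := ntensmx (E i) n.+1.
(* T_(n+2) is read as an element of M_k(B) with k = m^(n+1): its first factor lies in B, and the n+1
   others form the coefficient matrix. The map f moves the B factor last; g moves the two factors
   created by [Delta] back to the front. *)
pose X p q i : C := (((fdim R N i) ^+ 2)%:C)%C * ((fdim R N i)^-1%:C)%C * B i p q.
pose f (c : 'I_(m ^ n.+1 * m)) : 'I_(m ^ n.+2) :=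
  mxtens_index ((mxtens_unindex c).2, (mxtens_unindex c).1).
pose g (c : 'I_(m ^ n.+3)) : 'I_(m ^ n.+1 * (m * m)) :=
  let st := mxtens_unindex (c : 'I_(m * (m * m ^ n.+1))) in
  let tp := mxtens_unindex st.2 in
  mxtens_index (tp.2, mxtens_index (st.1, tp.1)).
move=> /psdP/(posmx_reindex f) pT.
have /psdP : psd (blockmx (fun p q => Lrep2 N (Delta N (X p q)))).
  apply/cp/psdP; rewrite blockmx_Lrep; move: pT; congr posmx.
  rewrite primary_mxSS; apply/matrixP => a b; rewrite mxE !summxE.
  apply: eq_bigr => i _; rewrite !mxE !mxtens_indexK /X /B.
  by rewrite /= !mulrA [RHS]mulrAC.
move=> /(posmx_reindex g) pD; apply/psdP; move: pD; congr posmx.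
rewrite primary_mxSS blockmx_Lrep2_Delta; apply/matrixP => a b; rewrite mxE !summxE.
apply: eq_bigr => i _; rewrite ntensmxSS !mxE !mxtens_indexK /X /B.
ring.
Qed.

(** For n = 2 the weight d_i^2 cancels both normalisations, leaving the sum of the M_i (x) M_i. *)
Lemma psd_primary_mx2 : psd (primary_mx R N 2).
Proof.
apply/psdP; move: (posmx_fusion_tens2 HF R); congr posmx.
rewrite primary_mxSS; apply: eq_bigr => i _; rewrite ntensmx1.
rewrite tens_scalel tens_scaler !scalerA -!rmorphM /=.
by rewrite -expr2 -exprMn mulfV ?expr1n ?scale1r // gt_eqF ?fdim_gt0.
Qed.

(* An operator commuting with the right multiplications belongs to
   [M_k(C) (x) B]; its columns at [one] then hold its coefficients. *)
Lemma rfusion_comm_entry k (Y : 'M[C]_(k * m)) p q a c :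
  (forall j, Y *m (1%:M *t rfusion_mx N R j) = (1%:M *t rfusion_mx N R j) *m Y) ->
  Y (mxtens_index (p, a)) (mxtens_index (q, c)) =
  \sum_b (N b c a)%:R * Y (mxtens_index (p, b)) (mxtens_index (q, one)).
Proof.
move=> /(_ c)/matrixP/(_ (mxtens_index (p, a)) (mxtens_index (q, one))).
rewrite !mxE !sum_mxtens (bigD1 q) //= (bigD1 c) //= tensmxE !mxE eqxx mul1r.
rewrite (fusion_1l HF) eqxx mulr1 big1 ?addr0 => [|b bc]; last first.
  by rewrite tensmxE !mxE (fusion_1l HF) eq_sym (negPf bc) mulr0 mulr0.
rewrite big1 ?addr0 => [|r rq]; last first.
  by rewrite big1 // => b _; rewrite tensmxE !mxE (negPf rq) mul0r mulr0.
move=> ->; rewrite (bigD1 p) //= [X in _ + X]big1 ?addr0 => [|r rp].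
  by apply: eq_bigr => b _; rewrite tensmxE !mxE eqxx mul1r.
by rewrite big1 // => b _; rewrite tensmxE !mxE eq_sym (negPf rp) !mul0r.
Qed.

(** Entry (a, q) of V r is the coefficient of the dual of x_a in the block (r, q) of Y. Since Y is
    hermitian, X p q is the sum over r of (Y r p)^* (Y r q), and the coefficient of x_j in x_a times
    the dual of x_b is N j b a, the entry (a, b) of M_j. *)
Lemma blockmx_coef_sqrt k (X : 'I_k -> 'I_k -> 'I_m -> C) (Y : 'M[C]_(k * m)) p q j :
  Y^H = Y -> Y *m Y = blockmx (fun p q => Lrep N (X p q)) ->
  (forall j, Y *m (1%:M *t rfusion_mx N R j) = (1%:M *t rfusion_mx N R j) *m Y) ->
  let V r : 'M[C]_(m, k) :=
    \matrix_(a, q) Y (mxtens_index (r, one)) (mxtens_index (q, a)) in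
  X p q j = (\sum_r (V r)^H *m M j *m V r) p q.
Proof.
move=> hY YY cY V.
(* Applying an element of B to x_1 returns its coefficients. *)
have -> : X p q j = (Y *m Y) (mxtens_index (p, j)) (mxtens_index (q, one)).
  rewrite YY mxE !mxtens_indexK summxE /= (bigD1 j) //= !mxE (fusion_1r HF) eqxx mulr1.
  rewrite big1 ?addr0 // => i ij.
  by rewrite !mxE (fusion_1r HF) (negPf ij) mulr0.
rewrite mxE sum_mxtens summxE; apply: eq_bigr => r _.
rewrite mxE (reindex_inj (inv_inj (dualK HF))) /=; apply: eq_bigr => b _.
rewrite (rfusion_comm_entry _ _ _ _ cY) [in RHS]mxE; congr (_ * _).
  apply: eq_bigr => a _; rewrite adjE !mxE (frobeniusr HF) mulrC; congr (_ * _).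
  by rewrite -[in LHS]hY adjE.
rewrite [RHS]mxE [RHS](rfusion_comm_entry _ _ _ _ cY) (bigD1 (dual b)) //=.
rewrite (fusion_one HF) eqxx mul1r big1 ?addr0 // => a ab.
by rewrite (fusion_one HF) (negPf ab) mul0r.
Qed.

Lemma Delta_cp_primary_mx3 : psd (primary_mx R N 3) -> Delta_cp R N.
Proof.
move=> /psdP pT k X /psdP pX; apply/psdP.
have [Y [hY YY cY]] := posmx_sqrt pX.
(* Left and right multiplications commute, so the block matrix of X commutes with 1 (x) right
   multiplication, and its square root inherits this. *)
have {}cY j : Y *m (1%:M *t rfusion_mx N R j) = (1%:M *t rfusion_mx N R j) *m Y.
  apply: cY; rewrite blockmx_Lrep mulmx_suml mulmx_sumr; apply: eq_bigr => i _.
  by rewrite !tensmx_mul mul1mx mulmx1 (fusion_mx_comm HF).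
pose V r : 'M[C]_(m, k) :=
  \matrix_(a, q) Y (mxtens_index (r, one)) (mxtens_index (q, a)).
have coefE j : \matrix_(p, q) X p q j = \sum_r (V r)^H *m M j *m V r.
  by apply/matrixP => p q; rewrite mxE (blockmx_coef_sqrt p q j hY YY cY).
rewrite blockmx_Lrep2_Delta.
have -> : \sum_j (\matrix_(p, q) X p q j) *t (((fdim R N j)^-1%:C)%C *: (M j *t M j))
    = \sum_r (V r *t 1%:M)^H *m primary_mx R N 3 *m (V r *t 1%:M).
  under eq_bigr => j _ do rewrite coefE tens_suml.
  rewrite exchange_big /=; apply: eq_bigr => r _.
  rewrite primary_mxSS mulmx_sumr mulmx_suml; apply: eq_bigr => j _.
  rewrite -scalemxAr -scalemxAl tens_compress ntensmx2.
  rewrite -scalemxAr -scalemxAl !(tens_scalel, tens_scaler) !scalerA -!rmorphM /=.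
  (* The weight d^2 of T_3 and its three normalisations combine to d^-1, the factor in [Delta]. *)
  congr (_%:C%C *: _).
  by have := fdim_gt0 j; move: (fdim R N j) => e /gt_eqF e0; field; rewrite e0.
by apply: posmx_sum => r; exact: posmx_conj.
Qed.

End FusionPositivity.

Theorem mainTheorem4 (R : realType) (m : nat)
    (N : 'I_m -> 'I_m -> 'I_m -> nat) (one : 'I_m) (dual : 'I_m -> 'I_m) :
  is_fusion_ring N one dual ->
  [<-> Delta_cp R N;
       psd (primary_mx R N 3);
       exists n : nat, (3 <= n)%N /\ psd (primary_mx R N n);
       forall n : nat, (1 <= n)%N -> psd (primary_mx R N n)].
Proof.
move=> HF; tfae.
- by move=> cp; apply: primary_mx_Delta => //; exact: psd_primary_mx2 HF R.
- by move=> pT; exists 3.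
- move=> [n [n3 pT]].
  (* Compression lowers n one step at a time down to 3. *)
  have {n n3 pT} pT3 : psd (primary_mx R N 3).
    elim: n n3 pT => // -[|[|[|n]]] // IH _ /(primary_mx_compress HF).
    exact: IH.
  (* T_1 is a compression of T_2; from T_2 upwards, T_3 >= 0 makes [Delta] completely positive,
     which drives the induction. *)
  case=> [|[|n]] // _.
    by apply: (primary_mx_compress HF); exact: psd_primary_mx2 HF R.
  elim: n => [|n]; first exact: psd_primary_mx2 HF R.
  by apply: primary_mx_Delta; exact: Delta_cp_primary_mx3 HF R pT3.
- by move=> pT; apply: (Delta_cp_primary_mx3 HF); exact: pT.
Qed.
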